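(* If $m$ halfspaces in $\mathbb{R}^n$, each of Gaussian measure $\delta < \frac{1}{2}$, have union containing the sphere $\{x \in \mathbb{R}^n : \|x\|_2 = \sqrt{n}\}$, then \[\delta \geq \Omega\left(\frac{n}{m\sqrt{\log\left(1 + \frac{m}{n}\right)}}\right).\]
   Context: The Gaussian measure of a set $H \subseteq \mathbb{R}^n$ is $\Pr[g \in H]$ for $g$ a standard $n$-dimensional Gaussian random vector. A halfspace is a set $\{x \in \mathbb{R}^n : \langle x, v\rangle \geq t\}$ for some nonzero $v$ and real $t$. The implicit constant in $\Omega$ is absolute; $\log$ is base $2$. *)

(* Defs.v *)
From HB Require Import structures.
From mathcomp Require Import all_boot all_order all_algebra.
From mathcomp Require Import all_classical all_reals all_analysis.

Set Implicit Arguments.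
Unset Strict Implicit.
Unset Printing Implicit Defensive.

Import Order.TTheory GRing.Theory Num.Theory.
Import numFieldNormedType.Exports.

Local Open Scope classical_set_scope.
Local Open Scope ring_scope.

Definition dotp (R : realType) (n : nat) (x y : 'rV[R]_n) : R :=
  \sum_(i < n) x 0 i * y 0 i.

(* The library's norm on 'rV[R]_n is the sup norm, hence this definition. *)
Definition norm2 (R : realType) (n : nat) (x : 'rV[R]_n) : R :=
  Num.sqrt (\sum_(i < n) x 0 i ^+ 2).

Definition halfspace (R : realType) (n : nat) (H : set 'rV[R]_n) : Prop :=
  exists v : 'rV[R]_n, exists t : R, v != 0 /\ H = [set x | dotp x v >= t].

Definition tuple_cons (R : realType) (n : nat)
    (p : measurableTypeR R * n.-tuple (measurableTypeR R)) :
  n.+1.-tuple (measurableTypeR R) := [tuple of p.1 :: p.2].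

Lemma measurable_tuple_cons (R : realType) (n : nat) :
  measurable_fun setT (@tuple_cons R n).
Proof. by apply: measurable_cons. Qed.

HB.instance Definition _ (R : realType) (n : nat) :=
  isMeasurableFun.Build _ _ _ _ (@tuple_cons R n) (@measurable_tuple_cons R n).

Definition std_normal (R : realType) : probability (measurableTypeR R) R :=
  normal_prob (0 : R) 1.

(* Law of n independent N(0, 1) random variables. *)
Fixpoint std_gaussian (R : realType) (n : nat) :
    probability (n.-tuple (measurableTypeR R)) R :=
  match n with
  | 0 => \d_ [tuple]
  | n.+1 => distribution (std_normal R \x std_gaussian R n)%E (@tuple_cons R n)
  end.

Lemma measurable_tuple_box (R : realType) (n : nat)
    (B : 'I_n -> set (measurableTypeR R)) :
  (forall i, measurable (B i)) ->
  measurable [set x : n.-tuple (measurableTypeR R) |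
              forall i, B i (tnth x i)].
Proof.
move=> mB.
have -> : [set x : n.-tuple (measurableTypeR R) | forall i, B i (tnth x i)] =
    \bigcap_(i in [set: 'I_n]) ((@tnth _ _ ^~ i) @^-1` B i).
  by apply/seteqP; split=> [x h i _|x h i]; exact: h.
apply: fin_bigcap_measurable => [|i _]; first exact: finite_finset.
by rewrite -[X in measurable X]setTI; exact: measurable_tnth.
Qed.

Lemma std_gaussianE (R : realType) (n : nat)
    (B : 'I_n -> set (measurableTypeR R)) :
  (forall i, measurable (B i)) ->
  std_gaussian R n [set x | forall i, B i (tnth x i)] =
  (\prod_(i < n) std_normal R (B i))%E.
Proof.
elim: n B => [|n IHn] B mB /=.
  by rewrite big_ord0 diracE mem_set// => -[].
rewrite big_ord_recl /distribution /pushforward /=.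
have -> : @tuple_cons R n @^-1` [set x | forall i, B i (tnth x i)] =
    B ord0 `*` [set x | forall i, B (lift ord0 i) (tnth x i)].
  apply/seteqP; split=> -[a x]; rewrite /tuple_cons /= => h.
    split=> [|i]; first exact: (h ord0).
    by have := h (lift ord0 i); rewrite tnthS.
  case: h => h0 h i; case: (unliftP ord0 i) => [j ->|->//].
  by rewrite tnthS.
have mB' i : measurable (B (lift ord0 i)) by exact: mB.
have mbox := measurable_tuple_box mB'.
rewrite product_measure1E//.
by congr (_ * _)%E; exact: IHn.
Qed.

Definition gaussian_measure (R : realType) (n : nat) (H : set 'rV[R]_n) : \bar R :=
  std_gaussian R n [set g | H (\row_(i < n) tnth g i)].

Definition log2 (R : realType) (x : R) : R := ln x / ln 2.

(* Main.v *)
Require Import Defs.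
From mathcomp Require Import all_boot all_order all_algebra.
From mathcomp Require Import all_classical all_reals all_analysis.
From mathcomp Require Import measurable_realfun ring lra.

Import Order.TTheory GRing.Theory Num.Theory.
Import numFieldNormedType.Exports.
Local Open Scope classical_set_scope.
Local Open Scope ring_scope.

(** Write the halfspaces as [<x, u_i> >= t_i] with [u_i] a unit vector.  Since
    [<g, u_i>] is standard normal, [delta < 1/2] forces [t_i > 0]; put
    [t = min_i t_i].  The heart of the matter is that a covering of the sphere
    forces [n exp(t^2/2) <= m]; the bound on [delta] then follows from the
    Gaussian tail estimate [delta >= k exp(-t^2/2) / (1 + t)].

    The polytope [K = {x | <x, u_i> <= t for all i}] contains no point of norm
    greater than [sqrt n], so it is compact.  Let [x] minimise
    [J(z) = Phi(z) exp(-a |z|^2)] over [K], where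
    [Phi(z) = sum_i exp(t <z, u_i>)] and [a] is slightly larger than
    [t^2/(2n)].  If [N] facets are tight at [x], every direction orthogonal to
    their normals stays in [K] on both sides, and averaging the second-order
    condition over this space of dimension at least [n - N] gives
    [2a (n - N) Phi(x) <= t^2 (Phi(x) - N exp(t^2))], up to a factor close
    to 1.  Hence [N > 0] and, in the limit, [Phi(x) >= n exp(t^2)], while
    [Phi(x) <= J(0) exp(a |x|^2) <= m exp(t^2/2)]. *)

(** * A second-order exponential bound and orthogonal projectors *)

(** For [z >= 0] the excess over 2 is [(exp z - 1)^2 exp(-z)], and [exp z - 1 <= z exp z] because
    [1 - z <= exp(-z)]. This serves as a Taylor bound in the second-order condition. *)
Lemma expRD_expRN_le (R : realType) (z : R) :
  expR z + expR (- z) <= 2 + z ^+ 2 * expR `|z|.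
Proof.
wlog z0 : z / 0 <= z.
  move=> H; case: (leP 0 z) => [/H//|/ltW z0].
  have := H (- z); rewrite opprK normrN sqrrN [expR (- z) + _]addrC; apply; lra.
rewrite ger0_norm//.
have e0 := expR_gt0 z.
have en : expR (- z) * expR z = 1 by rewrite mulrC expRxMexpNx_1.
have h1 : expR z - 1 <= z * expR z.
  have := expR_ge1Dx (- z) => /(ler_wpM2r (ltW e0)); rewrite en; lra.
have h0 : 0 <= expR z - 1 by have := expR_ge1Dx z; lra.
have h2 : (expR z - 1) ^+ 2 <= (z * expR z) ^+ 2.
  by rewrite ler_pXn2r// nnegrE mulr_ge0// ltW.
have := ler_wpM2r (expR_ge0 (- z)) h2.
have -> : (expR z - 1) ^+ 2 * expR (- z) = expR z * (expR (- z) * expR z) -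
    2 * (expR (- z) * expR z) + expR (- z) by ring.
have -> : (z * expR z) ^+ 2 * expR (- z) =
    z ^+ 2 * expR z * (expR (- z) * expR z) by ring.
rewrite en; lra.
Qed.

(** The witness is [1 - A^T (A A^T)^-1 A]. The Gram matrix [A A^T] is invertible because
    [w A A^T = 0] forces [|w A|^2 = 0]; the trace follows by cyclicity. *)
Lemma mxtrace_orthogonal_projector (R : realType) (r n : nat)
    (A : 'M[R]_(r, n)) :
  row_free A -> exists P : 'M[R]_n,
    [/\ P^T = P, P *m P = P, A *m P = 0 & \tr P = n%:R - r%:R].
Proof.
move=> fA.
have dot0 (k : nat) (w : 'rV[R]_k) : w *m w^T = 0 -> w = 0.
  move=> /(congr1 (fun M : 'M[R]_1 => M 0 0)); rewrite !mxE => /eqP.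
  rewrite psumr_eq0 => [|i _]; last by rewrite mxE -expr2 sqr_ge0.
  move=> /allP h; apply/rowP => i; rewrite mxE.
  have := h i (mem_index_enum _) => /=.
  by rewrite mxE mulf_eq0 => /orP[/eqP|/eqP].
have uG : A *m A^T \in unitmx.
  rewrite -row_free_unit -kermx_eq0; apply/eqP/row_matrixP => i.
  rewrite row0; set w := row i _.
  have wG : w *m (A *m A^T) = 0 by apply/sub_kermxP; exact: row_sub.
  have : w *m A = 0.
    by apply: dot0; rewrite trmx_mul mulmxA -(mulmxA w) wG mul0mx.
  by move/eqP; rewrite mulmx_free_eq0 // => /eqP.
set G := A *m A^T in uG.
have GT : G^T = G by rewrite /G trmx_mul trmxK.
exists (1%:M - A^T *m invmx G *m A); split.
- by rewrite linearB /= trmx1 !trmx_mul trmxK trmx_inv GT mulmxA.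
- rewrite mulmxBl mul1mx mulmxBr mulmx1.
  rewrite [X in _ - (_ - X)](_ : _ = A^T *m invmx G *m A) ?subrr ?subr0//.
  rewrite -!mulmxA; congr (_ *m _); rewrite !mulmxA; congr (_ *m _).
  by rewrite -(mulmxA (invmx G)) mulVmx// mul1mx.
- by rewrite mulmxBr mulmx1 !mulmxA mulmxV// mul1mx subrr.
- by rewrite linearB /= mxtrace1 mxtrace_mulC mulmxA mulmxV// mxtrace1.
Qed.

(** * Normal densities and the law of a linear form of a Gaussian vector *)

(** Both sides are the joint density of [(X, Y)], where [X] is standard normal and [Y] given [X = x]
    is normal with mean [c + a x] and deviation [s]. The right side is the marginal of [Y] times the
    conditional density of [X]. *)
Lemma normal_pdf_complete_square (R : realType) (a s c x y : R) : 0 < s ->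
  normal_pdf 0 1 x * normal_pdf (c + a * x) s y =
  normal_pdf c (Num.sqrt (a ^+ 2 + s ^+ 2)) y *
  normal_pdf (a * (y - c) / (a ^+ 2 + s ^+ 2))
    (s / Num.sqrt (a ^+ 2 + s ^+ 2)) x.
Proof.
move=> s0; set S := Num.sqrt _.
have S20 : 0 < a ^+ 2 + s ^+ 2 by rewrite ltr_wpDl ?sqr_ge0 ?exprn_gt0.
have S0 : 0 < S by rewrite sqrtr_gt0.
have SE : S ^+ 2 = a ^+ 2 + s ^+ 2 by rewrite sqr_sqrtr ?ltW.
rewrite !normal_pdfE ?gt_eqF ?divr_gt0//.
rewrite mulrACA [RHS]mulrACA; congr (_ * _).
  rewrite /normal_peak -!invfM -!sqrtrM; last 2 first.
  - by rewrite mulrn_wge0// mulr_ge0 ?pi_ge0 ?sqr_ge0.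
  - by rewrite mulrn_wge0// mulr_ge0 ?pi_ge0 ?sqr_ge0.
  congr (Num.sqrt _)^-1; field; exact: lt0r_neq0.
rewrite /normal_fun -!expRD; congr expR.
rewrite subr0 !expr_div_n SE; field.
by rewrite !lt0r_neq0.
Qed.

(** The Radon-Nikodym derivative of the law agrees almost everywhere with [normal_pdf], since both
    have the same integral over every measurable set. *)
Lemma integral_std_normal (R : realType) (f : measurableTypeR R -> \bar R) :
  measurable_fun setT f -> (forall x, 0 <= f x)%E ->
  (\int[std_normal R]_x f x =
   \int[lebesgue_measure]_x (f x * (normal_pdf 0 1 x)%:E))%E.
Proof.
move=> mf f0.
have dom := normal_prob_dominates (0 : R) 1.
rewrite -(Radon_Nikodym_SigmaFinite.change_of_variables dom)//.
have mpdf : measurable_fun setT (fun x : R => (normal_pdf 0 1 x)%:E).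
  by apply/measurable_EFinP; exact: measurable_normal_pdf.
apply: ae_eq_integral => //=.
- apply: emeasurable_funM => //; apply: measurable_int.
  exact: Radon_Nikodym_SigmaFinite.f_integrable.
- exact: emeasurable_funM.
apply: ae_eqe_mul2l; apply: integral_ae_eq => //=.
- exact: Radon_Nikodym_SigmaFinite.f_integrable.
- by move=> E _ mE; rewrite -Radon_Nikodym_SigmaFinite.f_integral.
Qed.

Lemma normal_pdf_even (R : realType) (s x : R) : s != 0 ->
  normal_pdf 0 s (- x) = normal_pdf 0 s x.
Proof. by move=> s0; rewrite !normal_pdfE// /normal_fun !subr0 sqrrN. Qed.

Lemma normal_prob_itvN (R : realType) (s b : R) : s != 0 ->
  normal_prob 0 s `]-oo, b] = normal_prob 0 s `[- b, +oo[.
Proof.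
move=> s0; rewrite /normal_prob -{1}(opprK b).
rewrite ge0_integration_by_substitutionNy.
- by apply: eq_integral => x _ /=; rewrite normal_pdf_even.
- by apply: continuous_subspaceT; exact: continuous_normal_pdf.
- by move=> x _; exact: normal_pdf_ge0.
Qed.

Lemma normal_prob_affine (R : realType) (a c b : R) : 0 < a ->
  normal_prob 0 1 `[b, +oo[ = normal_prob c a `[c + a * b, +oo[.
Proof.
move=> a0; rewrite /normal_prob.
pose F : R -> R := cst c + a *: (id : R -> R).
have FE x : F x = c + a * x by [].
have dF (x : R) : is_derive x (1 : R) F a.
  have h := is_deriveD (is_derive_cst c x (1 : R))
    (is_deriveZ a (is_derive_id x (1 : R))).
  by apply: is_derive_eq h _; rewrite add0r; exact: mulr1.
have F'E : derive1 F = cst a.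
  by apply/funext => x; rewrite derive1E; apply: derive_val.
have cF : continuous F.
  move=> x; apply: differentiable_continuous; apply/derivable1_diffP.
  exact: ex_derive.
rewrite -FE (@increasing_ge0_integration_by_substitutiony _ F).
- apply: eq_integral => x _ /=; rewrite F'E; congr EFin.
  rewrite /= !fctE /= !normal_pdfE ?gt_eqF// /normal_peak /normal_fun.
  rewrite [RHS]mulrAC; congr (_ * _).
    rewrite expr1n mul1r -mulrnAr sqrtrM ?sqr_ge0// sqrtr_sqr gtr0_norm//.
    by rewrite invfM mulrAC mulVf ?gt_eqF// mul1r.
  rewrite FE; congr expR; field; exact: lt0r_neq0.
- by move=> x y _ _ xy; rewrite !FE ltrD2l ltr_pM2l.
- by rewrite F'E => x _; exact: cst_continuous.
- by rewrite F'E; exact: is_cvg_cst.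
- by rewrite F'E; exact: is_cvg_cst.
- split; first by move=> x _; exact: ex_derive.
  by apply: cvg_at_right_filter; exact: cF.
- apply/cvgryPge => M.
  apply: filterS (nbhs_pinfty_ge (num_real (a^-1 * (M - c)))) => x /=.
  by rewrite FE -lerBlDl -ler_pdivrMl.
- by apply: continuous_subspaceT; apply: continuous_normal_pdf; rewrite gt_eqF.
- by move=> x _; exact: normal_pdf_ge0.
Qed.

(** Tonelli lets the integral over [x] be taken first. After completing the square, the only factor
    depending on [x] is a normal density, which integrates to 1. *)
Lemma normal_prob_mixture (R : realType) (a s c : R) B : 0 < s ->
  measurable B ->
  (\int[std_normal R]_x normal_prob (c + a * x)%R s B =
   normal_prob c (Num.sqrt (a ^+ 2 + s ^+ 2)) B)%E.
Proof.
move=> s0 mB.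
have S20 : 0 < a ^+ 2 + s ^+ 2 by rewrite ltr_wpDl ?sqr_ge0 ?exprn_gt0.
have sn0 : s != 0 by rewrite gt_eqF.
(* The indicator of [B] is put into the integrand so that both integrals run over the whole line. *)
pose g (z : measurableTypeR R * measurableTypeR R) : \bar R :=
  (normal_pdf (c + a * z.1) s z.2 * \1_B z.2)%:E.
pose f z : \bar R := ((normal_pdf 0 1 z.1)%:E * g z)%E.
have mpdf (h k : R * R -> R) (t : R) : t != 0 -> measurable_fun setT h ->
    measurable_fun setT k ->
    measurable_fun setT (fun z : measurableTypeR R * measurableTypeR R =>
      normal_pdf (h z) t (k z)).
  move=> t0 mh mk; under eq_fun do rewrite normal_pdfE// /normal_fun.
  apply: measurable_funM => //; apply: measurableT_comp => //.
  apply: measurable_funM => //; apply: measurableT_comp => //.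
  by apply: measurable_funX; exact: measurable_funB.
have mg : measurable_fun setT g.
  apply/measurable_EFinP; apply: measurable_funM.
  - apply: mpdf => //; apply: measurable_funD => //.
    by apply: measurable_funM.
  - by apply: measurableT_comp.
have mf : measurable_fun setT f.
  by apply: emeasurable_funM => //; apply/measurable_EFinP; exact: mpdf.
have g0 z : (0 <= g z)%E by rewrite lee_fin mulr_ge0 ?normal_pdf_ge0.
have f0 z : (0 <= f z)%E by rewrite mule_ge0// lee_fin normal_pdf_ge0.
have gE : fubini_F lebesgue_measure g = fun x => normal_prob (c + a * x) s B.
  apply/funext => x; rewrite /fubini_F /normal_prob [RHS]integral_mkcond.
  apply: eq_integral => y _; rewrite patchE /g /= indicE.
  by case: (_ \in _); rewrite ?mulr0 ?mulr1.
have mP : measurable_fun setT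
    (fun x : measurableTypeR R => normal_prob (c + a * x) s B).
  by rewrite -gE; exact: measurable_fun_fubini_tonelli_F.
have fE x : fubini_F lebesgue_measure f x =
    (normal_prob (c + a * x) s B * (normal_pdf 0 1 x)%:E)%E.
  rewrite /fubini_F /f /= ge0_integralZl//;
    last by rewrite lee_fin normal_pdf_ge0.
    by rewrite muleC -[X in (X * _)%E]/(fubini_F lebesgue_measure g x) gE.
  by apply: measurableT_comp mg _; exact: measurable_pair1.
rewrite integral_std_normal//.
under eq_integral do rewrite -fE.
rewrite fubini_tonelli//=.
rewrite /normal_prob [RHS]integral_mkcond; apply: eq_integral => y _.
rewrite patchE /fubini_G /f /g /= indicE; case: (_ \in _); last first.
  by rewrite integral0_eq// => x _; rewrite mulr0 mule0.
set S := Num.sqrt _.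
under eq_integral do rewrite mulr1 -EFinM normal_pdf_complete_square// EFinM.
rewrite ge0_integralZl//; first by rewrite integral_normal_pdf mule1.
- by apply/measurable_EFinP; exact: measurable_normal_pdf.
- by move=> x _; rewrite lee_fin normal_pdf_ge0.
- by rewrite lee_fin normal_pdf_ge0.
Qed.

Lemma sqr_norm2 (R : realType) n (x : 'rV[R]_n) : norm2 x ^+ 2 = dotp x x.
Proof.
rewrite /norm2 sqr_sqrtr; last by apply: sumr_ge0 => i _; exact: sqr_ge0.
by apply: eq_bigr => i _; rewrite expr2.
Qed.

Lemma norm2_gt0 (R : realType) n (x : 'rV[R]_n) : x != 0 -> 0 < norm2 x.
Proof.
move=> x0; have ge0 i : true -> 0 <= x 0 i ^+ 2 by rewrite sqr_ge0.
rewrite sqrtr_gt0 lt_neqAle sumr_ge0// andbT eq_sym psumr_neq0//.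
have /rV0Pn[i xi0] := x0; apply/hasP; exists i; rewrite ?mem_index_enum//=.
by rewrite exprn_even_gt0.
Qed.

Lemma normal_prob_halfline_norm (R : realType) (a c b : R) : a != 0 ->
  normal_prob 0 1 [set x | b <= c + a * x] = normal_prob c `|a| `[b, +oo[.
Proof.
move=> a0; have na0 : 0 < `|a| by rewrite normr_gt0.
have bE : b = c + `|a| * ((b - c) / `|a|).
  by rewrite mulrC divfK ?gt_eqF// addrC subrK.
rewrite {2}bE -normal_prob_affine//.
have [ag0|al0|/eqP] := ltrgtP a 0; last by rewrite (negbTE a0).
- rewrite ltr0_norm// invrN mulrN -normal_prob_itvN ?oner_eq0//.
  congr (normal_prob _ _ _); apply/seteqP; split => x /=; rewrite in_itv/=.
    by rewrite ler_ndivlMr// lerBlDl mulrC.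
  by rewrite ler_ndivlMr// lerBlDl mulrC.
- rewrite gtr0_norm//.
  congr (normal_prob _ _ _); apply/seteqP.
  split => x /=; rewrite in_itv/= andbT.
    by rewrite ler_pdivrMr// lerBlDl mulrC.
  by rewrite ler_pdivrMr// lerBlDl mulrC.
Qed.

Lemma measurable_superlevel d (T : measurableType d) (R : realType)
    (f : T -> R) (b : R) :
  measurable_fun setT f -> measurable [set x | b <= f x].
Proof.
move=> mf; rewrite (_ : [set x | _] = f @^-1` `[b, +oo[).
  by rewrite -[X in measurable X]setTI; exact: mf.
by apply/seteqP; split => x /=; rewrite in_itv/= andbT.
Qed.

(** Induction on [n] for all offsets [c] at once: fixing the first coordinate [x] moves
    [v 0 ord0 * x] into the offset, and [normal_prob_mixture] then averages over [x]. *)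
Lemma std_gaussian_linear (R : realType) n (v : 'rV[R]_n) (c b : R) : v != 0 ->
  std_gaussian R n [set g | b <= c + \sum_(i < n) tnth g i * v 0 i] =
  normal_prob c (norm2 v) `[b, +oo[.
Proof.
elim: n v c => [|n IHn] v c v0; first by rewrite thinmx0 eqxx in v0.
rewrite /=  /distribution /pushforward /=.
pose w : 'rV[R]_n := \row_j v 0 (lift ord0 j).
set A := (X in (_ \x _)%E X).
have AE : A = [set z | b <= (c + v 0 ord0 * z.1) +
    \sum_(i < n) tnth z.2 i * w 0 i].
  apply/seteqP; split => -[x g]; rewrite /A /tuple_cons /= big_ord_recl.
    rewrite tnth0 mulrC addrA => /le_trans; apply; rewrite lerD2l.
    by apply: ler_sum => i _; rewrite tnthS mxE.
  rewrite tnth0 mulrC addrA => /le_trans; apply; rewrite lerD2l.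
  by apply: ler_sum => i _; rewrite tnthS mxE.
have normE : norm2 v = Num.sqrt (v 0 ord0 ^+ 2 + norm2 w ^+ 2).
  rewrite sqr_norm2 /norm2 big_ord_recl; congr (Num.sqrt (_ + _)).
  by apply: eq_bigr => i _; rewrite !mxE expr2.
(* For [w = 0] the induction hypothesis does not apply, but the form then depends on the first
   coordinate alone, with a nonzero coefficient. *)
rewrite AE; have [w0|w0] := eqVneq w 0.
  have v00 : v 0 ord0 != 0.
    apply: contra_neq v0 => v00; apply/rowP => i; rewrite mxE.
    case: (unliftP ord0 i) => [j ->|->//].
    by move/rowP/(_ j): w0; rewrite !mxE.
  rewrite (_ : [set z | _] =
      [set x | b <= c + v 0 ord0 * x] `*` setT); last first.
    apply/seteqP; split => -[x g] /=; rewrite w0.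
      by under eq_bigr do rewrite mxE mulr0; rewrite big1_eq addr0.
    by under eq_bigr do rewrite mxE mulr0; rewrite big1_eq addr0 => -[].
  rewrite product_measure1E//; last first.
    apply: (@measurable_superlevel _ (measurableTypeR R)).
    by apply: measurable_funD => //; exact: measurable_funM.
  transitivity (normal_prob 0%R 1%R [set x | (b <= c + v 0 ord0 * x)%R] * 1)%E.
    by congr (_ * _)%E; exact: (probability_setT (std_gaussian R n)).
  rewrite mule1 normal_prob_halfline_norm// normE w0.
  by rewrite sqr_norm2 /dotp big1 ?addr0 ?sqrtr_sqr// => i _; rewrite mxE mul0r.
rewrite normE -normal_prob_mixture ?norm2_gt0//.
apply: eq_integral => x _.
rewrite -IHn//=; congr (std_gaussian _ _ _).
by apply/seteqP; split => g; rewrite /xsection /= ?inE.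
Qed.

Lemma gaussian_measure_halfspace (R : realType) n (v : 'rV[R]_n) (b : R) :
  v != 0 ->
  gaussian_measure [set x | dotp x v >= b] = normal_prob 0 (norm2 v) `[b, +oo[.
Proof.
move=> v0; rewrite -std_gaussian_linear//; congr (std_gaussian _ _ _).
have dotE (g : n.-tuple R) :
    dotp (\row_i tnth g i) v = \sum_(i < n) tnth g i * v 0 i.
  by apply: eq_bigr => i _; rewrite mxE.
by apply/seteqP; split => g /=; rewrite add0r dotE.
Qed.

(** * Lower bounds for normal tails *)

(** The half-lines on either side of 0 cover the line, and by symmetry neither weighs more than the
    tail from [b]. Thus a measure below 1/2 forces a positive threshold. *)
Lemma normal_tail_ge_half (R : realType) (s b : R) : s != 0 -> b <= 0 ->
  ((1 / 2)%:E <= normal_prob 0%R s `[b, +oo[)%E.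
Proof.
move=> s0 b0; pose P : probability _ R := normal_prob 0 s.
have h1 : (P `]-oo, 0%R]%classic <= P `[b, +oo[%classic)%E.
  rewrite /P /= normal_prob_itvN// oppr0; apply: (le_measure P); rewrite ?inE//.
  by apply: subset_itvr; rewrite bnd_simp.
have h2 : (P `[0%R, +oo[%classic <= P `[b, +oo[%classic)%E.
  apply: (le_measure P); rewrite ?inE//.
  by apply: subset_itvr; rewrite bnd_simp.
have : (1 <= P `[b, +oo[%classic + P `[b, +oo[%classic)%E.
  rewrite -(@probability_setT _ _ _ P).
  apply: (@le_trans _ _ (P (`]-oo, 0%R] `|` `[0%R, +oo[)%classic)).
    apply: (le_measure P); rewrite ?inE//; first exact: measurableU.
    by move=> x _ /=; rewrite !in_itv/= andbT; apply/orP; exact: le_total.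
  by apply: le_trans (measureU2 _ _ _) _ => //; exact: leeD.
rewrite -[normal_prob 0 s `[b, +oo[]/(P `[b, +oo[%classic).
have /fineK <- : P `[b, +oo[%classic \is a fin_num by exact: fin_num_measure.
by rewrite -EFinD !lee_fin; lra.
Qed.

(** The tail contains the interval from [t] to [u = t + 1/(1 + t)], whose mass is at least its
    length times the density at [u]. *)
Lemma std_normal_tail_ge (R : realType) (t : R) : 0 <= t ->
  ((normal_peak 1 * expR (- (3 / 2)) * (expR (- (t ^+ 2 / 2)) / (1 + t)))%:E <=
   normal_prob 0%R 1%R `[t, +oo[)%E.
Proof.
move=> t0; have t1 : 0 < 1 + t by rewrite ltr_pwDl.
set u := t + (1 + t)^-1.
have ut : t <= u by rewrite lerDl invr_ge0 ltW.
apply: (@le_trans _ _ (normal_prob 0%R 1%R `[t, u])); last first.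
  apply: (le_measure (normal_prob 0 1 : probability _ R)); rewrite ?inE//.
  by move=> x /=; rewrite !in_itv/= => /andP[->].
rewrite /normal_prob.
have h : (\int[lebesgue_measure]_(x in `[t, u])
      (cst (normal_pdf 0%R 1%R u)%:E x) <=
    \int[lebesgue_measure]_(x in `[t, u]) (normal_pdf 0 1 x)%:E)%E.
  apply: ge0_le_integral => //.
  - by move=> x _; rewrite lee_fin normal_pdf_ge0.
  - by apply/measurable_EFinP/measurable_funTS; exact: measurable_normal_pdf.
  move=> x /=; rewrite in_itv/= => /andP[tx xu].
  rewrite lee_fin !normal_pdfE ?oner_eq0// ler_wpM2l ?normal_peak_ge0//.
  rewrite ler_expR !subr0 ler_pM2r ?invr_gt0 ?mulrn_wgt0 ?exprn_gt0// lerN2.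
  by rewrite ler_sqr// nnegrE; lra.
apply: le_trans h.
  rewrite integral_cst//= lebesgue_measure_itv/= lte_fin.
  rewrite ltrDl invr_gt0 t1 -EFinD -EFinM lee_fin /u addrAC subrr add0r mulrA.
  rewrite ler_pM2r ?invr_gt0// normal_pdfE ?oner_eq0// -!mulrA.
  rewrite ler_wpM2l ?normal_peak_ge0// /normal_fun -expRD ler_expR.
  (* With [q = 1/(1 + t)], [u^2/2 = t^2/2 + t q + q^2/2] exceeds [t^2/2] by at most 3/2, since
     [t q <= 1] and [q^2 <= 1]. *)
  have : (1 + t)^-1 <= 1 by rewrite invf_le1// lerDl.
  have : t * (1 + t)^-1 <= 1 by rewrite ler_pdivrMr// mul1r lerDr.
  have : 0 <= (1 + t)^-1 by rewrite invr_ge0 ltW.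
  rewrite subr0 expr1n; set q := (1 + t)^-1 => q0 tq q1.
  have : q ^+ 2 <= 1 by rewrite expr_le1.
  lra.
Qed.

(** * Inner products, orthogonal frames and the polytope *)

Lemma dotpE (R : realType) n (x y : 'rV[R]_n) : dotp x y = (x *m y^T) 0 0.
Proof. by rewrite mxE; apply: eq_bigr => i _; rewrite mxE. Qed.

Lemma dotpC (R : realType) n (x y : 'rV[R]_n) : dotp x y = dotp y x.
Proof. by apply: eq_bigr => i _; rewrite mulrC. Qed.

Lemma dotpDl (R : realType) n (x y z : 'rV[R]_n) :
  dotp (x + y) z = dotp x z + dotp y z.
Proof. by rewrite !dotpE mulmxDl mxE. Qed.

Lemma dotpZl (R : realType) n k (x y : 'rV[R]_n) :
  dotp (k *: x) y = k * dotp x y.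
Proof. by rewrite !dotpE -scalemxAl mxE. Qed.

Lemma dotpZr (R : realType) n k (x y : 'rV[R]_n) :
  dotp x (k *: y) = k * dotp x y.
Proof. by rewrite dotpC dotpZl dotpC. Qed.

Lemma dotp0l (R : realType) n (x : 'rV[R]_n) : dotp 0 x = 0.
Proof. by rewrite dotpE mul0mx mxE. Qed.

Lemma dotp_ge0 (R : realType) n (x : 'rV[R]_n) : 0 <= dotp x x.
Proof. by apply: sumr_ge0 => i _; rewrite -expr2 sqr_ge0. Qed.

Lemma dotp_sqrD (R : realType) n (x y : 'rV[R]_n) :
  dotp (x + y) (x + y) = dotp x x + 2 * dotp x y + dotp y y.
Proof.
by rewrite dotpDl !(dotpC _ _ _ (x + y)) !dotpDl (dotpC _ _ y x); ring.
Qed.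

(* The rows of the orthogonal projector onto the complement of the span of
   the [u i] form a Parseval frame of that complement. *)
Lemma orthogonal_frame (R : realType) (n m : nat) (u : 'I_m -> 'rV[R]_n)
    (T : {set 'I_m}) :
  exists e : 'I_n -> 'rV[R]_n,
    [/\ forall i j, i \in T -> dotp (e j) (u i) = 0,
        n%:R - #|T|%:R <= \sum_j dotp (e j) (e j) &
        forall v, \sum_j dotp (e j) v ^+ 2 <= dotp v v].
Proof.
pose A := \matrix_(k < #|T|) u (enum_val k).
(* The normals may be linearly dependent, so the projector is built from [row_base A]; its trace is
   [n] minus the rank, and the rank is at most [#|T|]. *)
have [P [PT PP AP trP]] :=
  mxtrace_orthogonal_projector _ _ _ _ (row_base_free A).
have eE j (v : 'rV[R]_n) : dotp (row j P) v = (v *m P) 0 j.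
  by rewrite dotpC mxE; apply: eq_bigr => k _; rewrite mxE -{1}PT mxE.
exists (fun j => row j P); split.
- move=> i j iT; rewrite eE.
  have : (u i <= row_base A)%MS.
    rewrite eq_row_base (_ : u i = row (enum_rank_in iT i) A) ?row_sub//.
    by rewrite rowK enum_rankK_in.
  by move=> /submxP[D ->]; rewrite -mulmxA AP mulmx0 mxE.
- rewrite (eq_bigr (fun j => P j j)) => [|j _]; last first.
    by rewrite eE -row_mul PP mxE.
  by rewrite -/(\tr P) trP lerD2l lerN2 ler_nat rank_leq_row.
- move=> v.
  have -> : \sum_j dotp (row j P) v ^+ 2 = dotp (v *m P) (v *m P).
    by apply: eq_bigr => j _; rewrite eE expr2.
  have PvP : dotp (v *m P) (v *m P) = dotp v (v *m P).
    by rewrite !dotpE trmx_mul PT !mulmxA -(mulmxA v) PP.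
  (* Pythagoras: [|v|^2 - |v P|^2 = |v - v P|^2]. *)
  have := dotp_ge0 _ _ (v - v *m P).
  rewrite -scaleN1r dotp_sqrD dotpZr dotpZl dotpZr PvP; lra.
Qed.

(** A point outside the ball could be shrunk onto the sphere by a factor [s < 1]. There some [u i]
    would give [t <= s * dotp x (u i) < dotp x (u i)], against the constraint. *)
Lemma dotp_le_cover_radius (R : realType) (n m : nat) (u : 'I_m -> 'rV[R]_n)
    (t : R) (x : 'rV[R]_n) : 0 < t ->
  (forall y, dotp y y = n%:R -> exists i, t <= dotp y (u i)) ->
  (forall i, dotp x (u i) <= t) -> dotp x x <= n%:R.
Proof.
move=> t0 cov xK; rewrite leNgt; apply/negP => nx.
have xx0 : 0 < dotp x x by exact: le_lt_trans nx.
pose s := Num.sqrt (n%:R / dotp x x).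
have s1 : s < 1.
  by rewrite -sqrtr1 ltr_sqrt// ltr_pdivrMr// mul1r.
have [] := cov (s *: x).
  rewrite dotpZl dotpZr mulrA -expr2 sqr_sqrtr ?divr_ge0 ?dotp_ge0//.
  by rewrite divfK ?gt_eqF.
move=> i; rewrite dotpZl => tsd.
have s0 : 0 <= s by exact: sqrtr_ge0.
have := xK i; have d0 : 0 < dotp x (u i).
  rewrite ltNge; apply/negP => d0.
  by have := mulr_ge0_le0 s0 d0; lra.
have : s * dotp x (u i) < dotp x (u i) by rewrite gtr_pMl.
lra.
Qed.

Lemma continuous_dotp (R : realType) n (f g : 'rV[R]_n -> 'rV[R]_n) :
  continuous f -> continuous g -> continuous (fun x => dotp (f x) (g x)).
Proof.
move=> cf cg; rewrite /dotp => x.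
apply: (continuous_big add_continuous) => i _ {}x; apply: cvgM.
- exact: (nbhs_filter x).
- exact: (@continuous_comp _ _ _ f (fun M : 'rV[R]_n => M 0 i) x
    (cf x) (@coord_continuous R 1 n 0 i (f x))).
- exact: (@continuous_comp _ _ _ g (fun M : 'rV[R]_n => M 0 i) x
    (cg x) (@coord_continuous R 1 n 0 i (g x))).
Qed.

Lemma compact_polytope (R : realType) (n m : nat) (u : 'I_m -> 'rV[R]_n)
    (t r : R) :
  (forall x, (forall i, dotp x (u i) <= t) -> dotp x x <= r) ->
  compact [set x : 'rV[R]_n | forall i, dotp x (u i) <= t].
Proof.
move=> bK; apply: bounded_closed_compact.
(* This radius avoids a square root: [2 |x_j| <= 1 + x_j^2 <= 1 + r]. *)
- exists (1 + `|r|); split => [|M rM x /bK xr]; first exact: num_real.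
  have M0 : 0 < M by apply: lt_trans rM; rewrite ltr_pwDl.
  rewrite /= [leLHS]/Num.norm /= mx_normrE; apply/bigmax_leP.
  split; first exact: ltW.
  move=> [i j] _ /=; rewrite ord1.
  have : x 0 j ^+ 2 <= dotp x x.
    rewrite /dotp (bigD1 j)//= -expr2 lerDl sumr_ge0// => k _.
    by rewrite -expr2 sqr_ge0.
  have := ler_norm r; have := sqr_ge0 (`|x 0 j| - 1).
  rewrite -(real_normK (num_real (x 0 j))); have := normr_ge0 (x 0 j).
  nra.
- rewrite (_ : [set x | _] = \bigcap_i [set x | dotp x (u i) <= t]); last first.
    by apply/seteqP; split => [x h i _|x h i]; exact: h.
  apply: closed_bigI => i _.
  apply: (preimage_closed _ (@closed_le _ _)) => y _.
  apply: (continuous_dotp _ _ id (fun=> u i)) => z; first exact: cvg_id.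
  have FF := @nbhs_filter [the topologicalType of 'rV[R]_n] z.
  exact: (@cvg_cst _ _ _ _ FF).
Qed.

(** * The minimiser over the polytope and the bound on the number of halfspaces *)

(** The minimum is compared with the values at [x + e y] and [x - e y] for one small [e > 0], and
    the result is divided by [e^2]. No limit is taken: the factor [expR h] absorbs the higher-order
    terms. *)
Lemma second_order_condition (R : realType) (n m : nat) (u : 'I_m -> 'rV[R]_n)
    (t a h : R) (x y : 'rV[R]_n)
    (w := fun i => expR (t * dotp x (u i)))
    (J := fun z : 'rV[R]_n =>
       (\sum_i expR (t * dotp z (u i))) * expR (- a * dotp z z)) :
  0 <= a -> 0 < h ->
  (forall i, dotp x (u i) <= t) ->
  (forall z, (forall i, dotp z (u i) <= t) -> J x <= J z) ->
  (forall i, dotp x (u i) = t -> dotp y (u i) = 0) ->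
  a * dotp y y * \sum_i w i <=
  expR h * t ^+ 2 / 2 * \sum_i w i * dotp y (u i) ^+ 2.
Proof.
move=> a0 h0 xK Jmin ytight.
pose d i := dotp y (u i).
(* The first bound keeps both points in the polytope: slack constraints allow a small move, and
   tight ones have [d i = 0]. The second makes the factor [exp |z|] of the Taylor bound at most
   [expR h]. *)
have [e e0 [eK eh]] : exists2 e, 0 < e &
    (forall i, e * `|d i| <= t - dotp x (u i) \/ d i = 0) /\
    (forall i, e * `|t * d i| <= h).
  have pos (b c : R) : 0 < c -> \forall e \near 0^'+, e * b <= c.
    move=> c0; have : e * b @[e --> 0^'+] --> 0 * b.
      by apply: cvg_at_right_filter; apply: cvgM => //; exact: cvg_cst.
    by rewrite mul0r => /cvgr_le; apply.
  near (0:R)^'+ => e; exists e => //; split.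
  - move=> i; have [->|dn0] := eqVneq (d i) 0; [by right|left].
    move: i dn0; near: e; apply: filter_forall => i.
    have [->|dn0] := eqVneq (d i) 0; first exact: nearW.
    have lt : 0 < t - dotp x (u i).
      rewrite subr_gt0 lt_neqAle xK andbT; apply: contra_neq dn0 => /ytight.
      exact.
    by apply: filterS (pos `|d i| _ lt) => e.
  - move=> i; move: i; near: e; apply: filter_forall => i.
    exact: pos.
pose p i := expR (t * (e * d i)); pose q i := expR (- (t * (e * d i))).
have inK s : s ^+ 2 = 1 -> forall i, dotp (x + (s * e) *: y) (u i) <= t.
  move=> /eqP; rewrite sqrf_eq1 => s1 i.
  rewrite dotpDl dotpZl -/(d i).
  have [|->] := eK i; last by rewrite mulr0 addr0.
  have := ler_norm (e * d i); have := ler_norm (- (e * d i)).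
  rewrite normrN normrM (gtr0_norm e0).
  by case/orP: s1 => /eqP ->; rewrite ?mulN1r ?mulNr ?mul1r; lra.
have J0 z : 0 <= J z.
  by rewrite mulr_ge0 ?expR_ge0// sumr_ge0// => i _; rewrite expR_ge0.
have JD s : J (x + (s * e) *: y) = (\sum_i w i * expR (t * (s * (e * d i)))) *
    expR (- a * (dotp x x + 2 * s * e * dotp x y +
                 s ^+ 2 * e ^+ 2 * dotp y y)).
  congr (_ * expR _).
    apply: eq_bigr => i _; rewrite -expRD; congr expR.
    by rewrite dotpDl dotpZl -/(d i); ring.
  by rewrite dotp_sqrD dotpZl !dotpZr; ring.
pose A := \sum_i w i * p i; pose B := \sum_i w i * q i; pose Phi := \sum_i w i.
have Jp : J (x + (1 * e) *: y) = A *
    expR (- a * (dotp x x + 2 * e * dotp x y + e ^+ 2 * dotp y y)).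
  rewrite JD; congr (_ * expR _); last by ring.
  by apply: eq_bigr => i _; rewrite mul1r.
have Jm : J (x + (-1 * e) *: y) = B *
    expR (- a * (dotp x x - 2 * e * dotp x y + e ^+ 2 * dotp y y)).
  rewrite JD; congr (_ * expR _); last by ring.
  by apply: eq_bigr => i _; rewrite mulN1r mulrN.
have A0 : 0 <= A by apply: sumr_ge0 => i _; rewrite mulr_ge0// expR_ge0.
have B0 : 0 <= B by apply: sumr_ge0 => i _; rewrite mulr_ge0// expR_ge0.
have Phi0 : 0 <= Phi by apply: sumr_ge0 => i _; rewrite expR_ge0.
(* Multiplying the values at [x + e y] and [x - e y] cancels the first-order
   terms, and AM-GM then bounds the product. *)
have PhiAB : Phi * expR (a * (e ^+ 2 * dotp y y)) <= (A + B) / 2.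
  have : J x * J x <= J (x + (1 * e) *: y) * J (x + (-1 * e) *: y).
    by apply: ler_pM => //; apply: Jmin; apply: inK; rewrite ?sqrrN expr1n.
  rewrite Jp Jm {1 2}/J -/Phi mulrACA [leRHS]mulrACA -!expRD.
  set E1 := expR _; set E2 := expR _ => le.
  have E12 : E1 = E2 * expR (a * (e ^+ 2 * dotp y y)) ^+ 2.
    rewrite /E1 /E2 -expRM_natl -expRD; congr expR; ring.
  have E20 : 0 < E2 by exact: expR_gt0.
  rewrite -ler_sqr ?nnegrE ?mulr_ge0 ?expR_ge0 ?addr_ge0// exprMn.
  have : Phi ^+ 2 * expR (a * (e ^+ 2 * dotp y y)) ^+ 2 <= A * B.
    by rewrite -(ler_pM2r E20) -mulrA [X in _ * X]mulrC -E12 expr2.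
  have := sqr_ge0 (A - B); rewrite expr_div_n; lra.
have AB : (A + B) / 2 <= Phi + e ^+ 2 * (expR h * t ^+ 2 / 2 *
    \sum_i w i * dotp y (u i) ^+ 2).
  rewrite -ler_pdivlMr ?invr_gt0// invrK -big_split/= !mulr_sumr -big_split/=.
  rewrite mulr_suml; apply: ler_sum => i _; rewrite -mulrDr.
  have := expRD_expRN_le _ (t * (e * d i)); rewrite -/(p i) -/(q i) => pq.
  have eh' : expR `|t * (e * d i)| <= expR h.
    by rewrite ler_expR mulrCA normrM (gtr0_norm e0).
  have := ler_wpM2l (sqr_ge0 (t * (e * d i))) eh'.
  have w0 : 0 <= w i by exact: expR_ge0.
  move=> pq'; have /(ler_wpM2l w0) := le_trans pq (lerD (lexx 2) pq').
  move=> /le_trans; apply; rewrite /d le_eqVlt; apply/orP; left; apply/eqP.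
  by field.
have := expR_ge1Dx (a * (e ^+ 2 * dotp y y)).
move=> /(ler_wpM2l Phi0) h1; have := le_trans (le_trans h1 PhiAB) AB.
rewrite mulrDr mulr1 lerD2l -/Phi => h2.
rewrite -(ler_pM2l (exprn_gt0 2 e0)); apply: le_trans h2.
rewrite le_eqVlt; apply/orP; left; apply/eqP; ring.
Unshelve. all: by end_near. Qed.

(** The slack [h] gives a finite form of the bound, in which the second-order condition can be used
    with strict inequalities; it is sent to 0 afterwards. *)
Lemma halfspace_cover_perturbed (R : realType) (n m : nat)
    (u : 'I_m -> 'rV[R]_n) (t h : R) :
  (0 < n)%N -> 0 < t -> 0 < h -> (forall i, dotp (u i) (u i) = 1) ->
  (forall x, dotp x x = n%:R -> exists i, t <= dotp x (u i)) ->
  n%:R * expR (t ^+ 2) <= m%:R * expR (h + expR h ^+ 2 * t ^+ 2 / 2).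
Proof.
move=> n0 t0 h0 u1 cov.
have n0' : 0 < n%:R :> R by rewrite ltr0n.
pose K := [set x : 'rV[R]_n | forall i, dotp x (u i) <= t].
have bK x : K x -> dotp x x <= n%:R by exact: dotp_le_cover_radius.
(* Of the two factors [expR h], one cancels the loss in the second-order condition and the other
   leaves the strict inequality that excludes [N = 0]. *)
pose a := expR h ^+ 2 * t ^+ 2 / (2 * n%:R).
have a0 : 0 <= a by rewrite divr_ge0 ?mulr_ge0 ?sqr_ge0// ltW.
pose J (z : 'rV[R]_n) :=
  (\sum_i expR (t * dotp z (u i))) * expR (- a * dotp z z).
have cJ : continuous J.
  have cexp (f : 'rV[R]_n -> R) : continuous f -> continuous (expR \o f).
    by move=> cf z; apply: continuous_comp; [exact: cf|exact: continuous_expR].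
  have cM (f g : 'rV[R]_n -> R) : continuous f -> continuous g ->
      continuous (fun z => f z * g z).
    move=> cf cg z; have FF := @nbhs_filter [the topologicalType of 'rV[R]_n] z.
    by apply: cvgM; [exact: cf|exact: cg].
  have cC (k : R) : continuous ((fun=> k) : 'rV[R]_n -> R).
    move=> z; have FF := @nbhs_filter [the topologicalType of 'rV[R]_n] z.
    exact: (@cvg_cst _ _ _ _ FF).
  apply: (cM); last apply: (cexp (fun z => - a * dotp z z)).
    apply: (continuous_big add_continuous) => i _.
    apply: (cexp (fun z => t * dotp z (u i))); apply: (cM) => //.
    apply: (continuous_dotp _ _ id (fun=> u i)) => z; first exact: cvg_id.
    have FF := @nbhs_filter [the topologicalType of 'rV[R]_n] z.
    exact: (@cvg_cst _ _ _ _ FF).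
  apply: (cM) => //.
  by apply: (continuous_dotp _ _ id id) => z; exact: cvg_id.
have K0 : K 0 by move=> i; rewrite dotp0l ltW.
have [x xK Jmin] : exists2 x, x \in K & forall z, z \in K -> J x <= J z.
  apply: EVT_min_rV; first by exists 0.
  - exact: compact_polytope bK.
  - exact: continuous_subspaceT.
have {}xK : K x by rewrite inE in xK.
pose w i := expR (t * dotp x (u i)); pose Phi := \sum_i w i.
pose T := [set i | dotp x (u i) == t]%SET.
have [e [eT eN eP]] := orthogonal_frame _ _ _ u T.
have ineq j : a * dotp (e j) (e j) * Phi <=
    expR h * t ^+ 2 / 2 * \sum_i w i * dotp (e j) (u i) ^+ 2.
  apply: second_order_condition => //.
  - by move=> z zK; apply: Jmin; rewrite inE.
  - by move=> i xi; apply: eT; rewrite inE xi.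
have w0 i : 0 <= w i by exact: expR_ge0.
(* The all-ones vector lies on the sphere, so there is at least one index and [Phi] is positive. *)
have [i0 _] : exists i, t <= dotp (const_mx 1) (u i).
  apply: cov; rewrite /dotp; under eq_bigr do rewrite !mxE mulr1.
  by rewrite big_const_ord iter_addr_0.
have Phi0 : 0 < Phi.
  by rewrite /Phi (bigD1 i0)//= ltr_wpDr ?expR_gt0// sumr_ge0.
pose N : R := #|T|%:R.
(* Sum over the frame: the squared lengths of the [e j] add up to at least [n - N]. On the right,
   tight indices contribute 0 and each other one at most its weight [w i]; a tight weight equals
   [expR (t ^+ 2)]. *)
have sum_ineq : a * (n%:R - N) * Phi <=
    expR h * t ^+ 2 / 2 * (Phi - N * expR (t ^+ 2)).
  have a1 : a * (n%:R - N) * Phi <= \sum_j a * dotp (e j) (e j) * Phi.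
    by rewrite -mulr_suml -mulr_sumr ler_pM2r// ler_wpM2l.
  apply: le_trans a1 _; apply: le_trans (ler_sum _ (fun j _ => ineq j)) _.
  rewrite -mulr_sumr ler_wpM2l ?divr_ge0 ?mulr_ge0 ?expR_ge0 ?(ltW t0)//.
  rewrite exchange_big/=.
  have -> : Phi - N * expR (t ^+ 2) = \sum_(i | i \notin T) w i.
    rewrite /Phi (bigID (mem T))/= (eq_bigr (fun=> expR (t ^+ 2))) => [|i].
      by rewrite sumr_const mulr_natl addrAC subrr add0r.
    by rewrite inE => /eqP xi; rewrite /w xi expr2.
  rewrite (bigID (mem T))/= big1 ?add0r => [|i iT].
    apply: ler_sum => i _; rewrite -mulr_sumr -[leRHS]mulr1 ler_wpM2l//.
    by rewrite -(u1 i).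
  by apply: big1 => j _; rewrite eT// expr0n mulr0.
have eh1 : 1 < expR h by rewrite expR_gt1.
have key : n%:R * expR (t ^+ 2) <= expR h * Phi.
  have : expR h * (n%:R - N) * Phi <= n%:R * (Phi - N * expR (t ^+ 2)).
    have c0 : 0 < expR h * t ^+ 2 / (2 * n%:R).
      by rewrite divr_gt0 ?mulr_gt0 ?expR_gt0 ?exprn_gt0.
    rewrite -(ler_pM2l c0); apply: le_trans (le_trans _ sum_ineq) _.
      by rewrite le_eqVlt; apply/orP; left; apply/eqP; rewrite /a; ring.
    rewrite le_eqVlt; apply/orP; left; apply/eqP; field.
    by rewrite gt_eqF.
  have [N0|N0] : N = 0 \/ 1 <= N.
    by rewrite /N; case: #|T| => [|k]; [left|right; rewrite ler1n].
  - rewrite N0 mul0r !subr0 => H.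
    have := ltr_pM2r (mulr_gt0 n0' Phi0) 1 (expR h); rewrite eh1 mul1r; lra.
  - move=> H; have Np : 0 < N by lra.
    rewrite -(ler_pM2l Np).
    have := ler_pM2r (mulr_gt0 n0' Phi0) 1 (expR h); rewrite (ltW eh1) mul1r.
    lra.
(* The origin lies in the polytope, and [J] equals [m] there. *)
have Jx0 : Phi * expR (- a * dotp x x) <= m%:R.
  have := Jmin 0; rewrite inE => /(_ K0).
  rewrite /J !dotp0l mulr0 expR0 mulr1.
  by under [leRHS]eq_bigr do rewrite dotp0l mulr0 expR0;
    rewrite sumr_const card_ord.
apply: le_trans key _; rewrite expRD mulrCA ler_wpM2l ?expR_ge0//.
have <- : a * n%:R = expR h ^+ 2 * t ^+ 2 / 2.
  by rewrite /a; field; rewrite gt_eqF.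
have : Phi * expR (- (a * n%:R)) <= m%:R.
  apply: le_trans Jx0; rewrite ler_wpM2l ?(ltW Phi0)// ler_expR mulNr lerN2.
  by rewrite ler_wpM2l//; exact: bK.
by rewrite expRN ler_pdivrMr ?expR_gt0.
Qed.

(** Let [h] tend to 0 from the right in the perturbed bound and cancel a factor
    [expR (t ^+ 2 / 2)]. *)
Lemma halfspace_cover_card (R : realType) (n m : nat)
    (u : 'I_m -> 'rV[R]_n) (t : R) :
  (0 < n)%N -> 0 < t -> (forall i, dotp (u i) (u i) = 1) ->
  (forall x, dotp x x = n%:R -> exists i, t <= dotp x (u i)) ->
  n%:R * expR (t ^+ 2 / 2) <= m%:R.
Proof.
move=> n0 t0 u1 cov.
pose g (h : R) := h + expR h ^+ 2 * t ^+ 2 / 2.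
pose f (h : R) := m%:R * expR (g h).
have cg : continuous g.
  move=> h; apply: cvgD; first exact: cvg_id.
  apply: cvgM; last exact: cvg_cst.
  apply: cvgM; last exact: cvg_cst.
  by apply: cvgM; exact: continuous_expR.
have fc : f h @[h --> 0^'+] --> f 0.
  apply: cvg_at_right_filter; apply: cvgM; first exact: cvg_cst.
  exact: (continuous_comp (cg 0) (@continuous_expR _ (g 0))).
have : n%:R * expR (t ^+ 2) <= f 0.
  apply: (cvgr_to_ge fc); near=> h; apply: halfspace_cover_perturbed => //.
rewrite /f /g add0r expR0 expr1n mul1r.
have -> : expR (t ^+ 2) = expR (t ^+ 2 / 2) * expR (t ^+ 2 / 2).
  by rewrite -expRD; congr expR; field.
by rewrite mulrA ler_pM2r ?expR_gt0.
Unshelve. all: by end_near. Qed.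

(** * From the cardinality bound to the bound on the measure *)

(** The logarithm is at least both 1 and [t^2/2], while [(1 + t)^2 <= 2 + 2 t^2]. *)
Lemma log2_1DexpR_ge (R : realType) (t r : R) : 0 <= t ->
  expR (t ^+ 2 / 2) <= r -> ((1 + t) / 4) ^+ 2 <= log2 (1 + r).
Proof.
move=> t0 tr.
have r0 : 0 < r := lt_le_trans (expR_gt0 _) tr.
have r1 : 1 <= r.
  by apply: le_trans tr; rewrite -expR0 ler_expR divr_ge0// sqr_ge0.
have ln2 : 0 < ln 2 :> R by rewrite ln_gt0// ltr1n.
have ln2' : ln 2 <= 1 :> R.
  by have := @le_ln1Dx R 1; rewrite -[1 + 1]/2; apply; lra.
have lnge : ln (1 + r) <= log2 (1 + r).
  by rewrite /log2 ler_pdivlMr// ler_piMr// ln_ge0// lerDl ltW.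
have l1 : t ^+ 2 / 2 <= ln (1 + r).
  rewrite -[leLHS]expRK ler_ln ?posrE ?expR_gt0 ?addr_gt0//; lra.
have l2 : 1 <= log2 (1 + r).
  rewrite /log2 ler_pdivlMr// mul1r ler_ln ?posrE ?addr_gt0//; lra.
have := sqr_ge0 (1 - t); rewrite expr_div_n; lra.
Qed.

(** In terms of reciprocals, the two factors compare separately: [m / n] with [expR (t ^+ 2 / 2)],
    and the square root with [(1 + t) / 4]. *)
Lemma gaussian_tail_vs_cardinality (R : realType) (n m t : R) : 0 <= t ->
  0 < n -> n * expR (t ^+ 2 / 2) <= m ->
  n / (m * Num.sqrt (log2 (1 + m / n))) <=
  4 * (expR (- (t ^+ 2 / 2)) / (1 + t)).
Proof.
move=> t0 n0 nm.
have e0 := expR_gt0 (t ^+ 2 / 2).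
have m0 : 0 < m by apply: lt_le_trans nm; rewrite mulr_gt0.
have r : expR (t ^+ 2 / 2) <= m / n by rewrite ler_pdivlMr// mulrC.
have q0 : 0 < (1 + t) / 4 by rewrite divr_gt0// ltr_pwDl.
have sq : (1 + t) / 4 <= Num.sqrt (log2 (1 + m / n)).
  by rewrite -[leLHS]gtr0_norm// -sqrtr_sqr ler_wsqrtr// log2_1DexpR_ge.
have s0 := lt_le_trans q0 sq.
have -> : 4 * (expR (- (t ^+ 2 / 2)) / (1 + t)) =
    (expR (t ^+ 2 / 2) * ((1 + t) / 4))^-1.
  by rewrite expRN; field; rewrite !lt0r_neq0 ?ltr_pwDl.
rewrite -[leLHS]invrK lef_pV2 ?posrE ?invr_gt0 ?divr_gt0 ?mulr_gt0 ?ltr_pwDl//.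
by rewrite invf_div [leRHS]mulrAC; apply: ler_pM => //; exact: ltW.
Qed.

Theorem theorem8 (R : realType) :
  exists c : R, 0 < c /\
    forall (n m : nat) (H : 'I_m -> set 'rV[R]_n) (delta : R),
      (forall i, halfspace (H i)) ->
      (forall i, gaussian_measure (H i) = delta%:E) ->
      delta < 1 / 2 ->
      [set x : 'rV[R]_n | norm2 x = Num.sqrt n%:R] `<=` \bigcup_i H i ->
      delta >= c * (n%:R / (m%:R * Num.sqrt (log2 (1 + m%:R / n%:R)))).
Proof.
pose k : R := normal_peak 1 * expR (- (3 / 2)).
have k0 : 0 < k by rewrite mulr_gt0 ?expR_gt0// normal_peak_gt0 ?oner_eq0.
(* [k] is the constant of the tail estimate, and 4 is lost in comparing [1 + t] with the square root
   of the logarithm. *)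
exists (k / 4); split; first by rewrite divr_gt0.
move=> n m H delta hH gH delta2 cover.
have /choice[vb hvb] : forall i, exists p : 'rV[R]_n * R,
    p.1 != 0 /\ H i = [set x | dotp x p.1 >= p.2].
  by move=> i; have [v [b]] := hH i; exists (v, b).
pose v i := (vb i).1; pose t i := (vb i).2 / norm2 (v i).
have v0 i : v i != 0 by case: (hvb i).
have s0 i : 0 < norm2 (v i) by exact: norm2_gt0.
have gE i : normal_prob 0 1 `[t i, +oo[ = delta%:E.
  rewrite (normal_prob_affine _ (norm2 (v i)) 0)// add0r.
  rewrite mulrC divfK ?gt_eqF// -gaussian_measure_halfspace// -(gH i).
  by case: (hvb i) => _ ->.
have t0 i : 0 < t i.
  rewrite ltNge; apply/negP => /(normal_tail_ge_half _ 1) => /(_ (oner_neq0 _)).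
  by rewrite gE lee_fin leNgt delta2.
have covered x : dotp x x = n%:R ->
    exists i, t i <= dotp x ((norm2 (v i))^-1 *: v i).
  move=> xx; have [|i _] := cover x.
    by rewrite /= -xx -sqr_norm2 sqrtr_sqr ger0_norm// sqrtr_ge0.
  case: (hvb i) => _ -> /= bx; exists i.
  by rewrite dotpZr mulrC ler_pM2r// invr_gt0.
have [i0 _] : exists i, t i <= dotp (const_mx 1) ((norm2 (v i))^-1 *: v i).
  apply: covered; rewrite /dotp; under eq_bigr do rewrite !mxE mulr1.
  by rewrite big_const_ord iter_addr_0.
(* In dimension 0 the normal of the halfspace [i0] would be zero. *)
have n0 : (0 < n)%N.
  rewrite lt0n; apply/eqP => n0; have := v0 i0; case/negP; apply/eqP/rowP.
  by move=> j; have : (j < 0)%N by apply: (leq_trans (ltn_ord j)); rewrite n0.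
(* With the smallest threshold as common [t], the unit normals still cover the sphere, and [gE i1]
   ties this [t] to [delta]. *)
pose i1 := [arg min_(i < i0) t i]%O.
have tmin i : t i1 <= t i by rewrite /i1; case: arg_minP => // j _; apply.
have card : n%:R * expR (t i1 ^+ 2 / 2) <= m%:R.
  apply: (halfspace_cover_card _ _ _ (fun i => (norm2 (v i))^-1 *: v i)) => //.
    move=> i; rewrite dotpZr dotpZl -sqr_norm2 mulrA -invfM -expr2 mulVf//.
    by rewrite expf_neq0// gt_eqF.
  move=> x /covered[i ti]; exists i; exact: le_trans ti.
have t1 := ltW (t0 i1).
have := std_normal_tail_ge _ _ t1; rewrite gE lee_fin -/k; apply: le_trans.
have n0' : 0 < n%:R :> R by rewrite ltr0n.
have := gaussian_tail_vs_cardinality _ _ _ _ t1 n0' card.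
rewrite -(ler_pM2l (_ : 0 < k / 4)) ?divr_gt0// => /le_trans; apply.
by rewrite (mulrA (k / 4)) divfK.
Qed.
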